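(* For every integer $\sigma\ge 2$ there exists $d_0$ such that for all integers $d\ge d_0$, $$\gamma_{\sigma,2}^{\,d-1} < \gamma_{\sigma,d}.$$ In particular, for fixed $\sigma$ and all sufficiently large $d$ the identity $\gamma_{\sigma,d}=\gamma_{\sigma,2}^{d-1}$ does not hold.
   Context: For strings $A_1,\ldots,A_d$ over a finite alphabet, $L(A_1,\ldots,A_d)$ denotes the length of a longest common (not necessarily contiguous) subsequence of all the $A_i$. For positive integers $n,\sigma,d$, $L_{n,\sigma,d}$ is the random variable $L(A_1,\ldots,A_d)$ where $A_1,\ldots,A_d$ are independent random strings of length $n$ whose characters are chosen uniformly and independently from $\Sigma=\{1,\ldots,\sigma\}$. The constant $\gamma_{\sigma,d}$ is defined as $\gamma_{\sigma,d}=\lim_{n\to\infty}\mathbf{E}[L_{n,\sigma,d}]/n$ (the limit exists by standard subadditivity arguments). *)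

(* Defs.v *)
From mathcomp Require Import all_boot all_order all_algebra.
From mathcomp Require Import all_classical all_reals all_analysis.

Set Implicit Arguments.
Unset Strict Implicit.
Unset Printing Implicit Defensive.

Import Order.TTheory GRing.Theory Num.Theory.
Import numFieldNormedType.Exports.

Local Open Scope ring_scope.
Local Open Scope classical_set_scope.

Definition common_subseq (T : eqType) (d : nat) (A : 'I_d -> seq T)
    (s : seq T) : bool :=
  [forall i, subseq s (A i)].

(* The range bound [\max_i size (A i)] only serves to make the maximum finite:
   for [0 < d] every common subsequence satisfies it (see [lcsP], [lcs_max]). *)
Definition lcs (T : finType) (d : nat) (A : 'I_d -> seq T) : nat :=
  \max_(k < (\max_(i < d) size (A i)).+1
       | [exists s : k.-tuple T, common_subseq A s]) k.

Lemma lcsP (T : finType) (d : nat) (A : 'I_d -> seq T) :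
  exists2 s : seq T, common_subseq A s & size s = lcs A.
Proof.
have h0 : [exists s : (@ord0 (\max_(i < d) size (A i))).-tuple T,
    common_subseq A s].
  by apply/existsP; exists [tuple]; apply/forallP => i; exact: sub0seq.
rewrite /lcs (bigop.bigmax_eq_arg ord0) //.
case: arg_maxnP => //= k /existsP[s sA] _.
by exists s => //; exact: size_tuple.
Qed.

Lemma lcs_max (T : finType) (d : nat) (A : 'I_d -> seq T) (s : seq T) :
  (0 < d)%N -> common_subseq A s -> (size s <= lcs A)%N.
Proof.
move=> d0 sA.
have sb : (size s < (\max_(i < d) size (A i)).+1)%N.
  rewrite ltnS.
  apply: leq_trans (leq_bigmax (F := fun i => size (A i)) (Ordinal d0)).
  by apply: size_subseq; exact: (forallP sA).
apply: (leq_bigmax_cond (F := fun k => nat_of_ord k) (Ordinal sb)).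
by apply/existsP; exists (in_tuple s).
Qed.

(* [d] independent strings of [n] independent uniform characters are a uniform
   element of the finite set of [d]-families of words of length [n], so the
   expectation of their LCS length is the average over that set. *)
Definition expected_lcs (R : realType) (n sigma d : nat) : R :=
  (\sum_(A : {ffun 'I_d -> n.-tuple 'I_sigma})
      (lcs (fun i => A i : seq 'I_sigma))%:R)
  / #|{: {ffun 'I_d -> n.-tuple 'I_sigma}}|%:R.

(* The limit exists for [0 < sigma] and [0 < d], as [expected_lcs] is
   superadditive in [n] and at most [n]. *)
Definition lcs_gamma (R : realType) (sigma d : nat) : R :=
  lim (expected_lcs R n sigma d / n%:R @[n --> \oo]).

(* Main.v *)
Require Import Defs.
From mathcomp Require Import all_boot all_order all_algebra.
From mathcomp Require Import all_classical all_reals all_analysis.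
From mathcomp Require Import zify ring lra.

Import Order.TTheory GRing.Theory Num.Theory.
Import numFieldNormedType.Exports.

Local Open Scope ring_scope.

(* The constants [gamma_{sigma,2}] and [gamma_{sigma,d}] are compared through an
   exponential upper bound and a polynomial lower bound. Weighting a pair of
   words by [y] to the power of its indel distance, the total weight satisfies a
   linear recursion and is exponentially smaller than the number of pairs, so
   [gamma_{sigma,2} <= 11/12] and the left-hand side decays exponentially in
   [d]. On the other hand Fekete's lemma gives [gamma_{sigma,d} >= E L_{n,d} / n]
   for every [n >= 1]; for [n = d] a fixed letter occurs in all [d] strings with
   probability at least [1 - d (1 - 1/sigma)^d], so [gamma_{sigma,d}] is at least
   of order [1/d]. *)

(** * Bernoulli-type inequalities and a limit *)

Lemma bernoulli_ge {R : realFieldType} (x : R) (k : nat) :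
  0 <= x <= 1 -> 1 - k%:R * (1 - x) <= x ^+ k.
Proof.
move=> /andP[x0 x1]; elim: k => [|k IHk]; first by rewrite expr0; lra.
have := ler_wpM2l x0 IHk; rewrite exprS -natr1.
have : 0 <= k%:R * (1 - x) ^+ 2 by rewrite mulr_ge0// sqr_ge0.
by nra.
Qed.

(** Bernoulli's inequality for the exponent [- k], in division-free form. *)
Lemma expr_bernoulli_le1 {R : realFieldType} (x : R) (k : nat) :
  0 <= x <= 1 -> x ^+ k * (1 + k%:R * (1 - x)) <= 1.
Proof.
move=> /andP[x0 x1]; elim: k => [|k IHk]; first by rewrite expr0; lra.
apply: le_trans IHk; rewrite exprSr -mulrA ler_wpM2l ?exprn_ge0//.
have : 0 <= k.+1%:R * (1 - x) ^+ 2 by rewrite mulr_ge0// sqr_ge0.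
by rewrite -natr1; nra.
Qed.

(** The sequence [a |-> x ^+ a] is convex, and the left-hand side is its secant through [a = b] and
    [a = b + 1]. *)
Lemma expr_ge_affine {R : realFieldType} (x : R) (a b : nat) : 0 <= x <= 1 ->
  x ^+ b * (1 + (b%:R - a%:R) * (1 - x)) <= x ^+ a.
Proof.
move=> x01; have /andP[x0 _] := x01; have [ab|/ltnW ba] := leqP a b.
  rewrite -(subnKC ab) exprD natrD (addrC a%:R) addrK -mulrA -[leRHS]mulr1.
  by rewrite ler_wpM2l ?exprn_ge0// expr_bernoulli_le1.
rewrite -(subnKC ba) exprD natrD opprD addrA subrr add0r mulNr.
by rewrite ler_wpM2l ?exprn_ge0// bernoulli_ge.
Qed.

(** With [x = z * z], the factor [n * z ^+ n] stays below [1 / (1 - z)] and the other factor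
    [z ^+ n] is geometric. *)
Lemma cvg_natr_expr {R : realType} (x : R) : 0 <= x < 1 ->
  (n%:R * x ^+ n @[n --> \oo] --> (0 : R))%classic.
Proof.
move=> /andP[x0 x1]; pose z := Num.sqrt x.
have z0 : 0 <= z by exact: sqrtr_ge0.
have z1 : z < 1 by rewrite -sqrtr1 ltr_sqrt.
have zx : x = z * z by rewrite -expr2 sqr_sqrtr.
have zn n : n%:R * z ^+ n <= (1 - z)^-1.
  rewrite -[leRHS]mul1r ler_pdivlMr ?subr_gt0//.
  have z01 : 0 <= z <= 1 by rewrite z0 ltW.
  have := expr_bernoulli_le1 z n z01; have := exprn_ge0 n z0.
  by nra.
apply: (@squeeze_cvgr _ _ _ _ (fun=> 0) (fun n => (1 - z)^-1 * z ^+ n)).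
- apply: nearW => n; rewrite mulr_ge0 ?exprn_ge0//=.
  by rewrite zx exprMn mulrA ler_wpM2r ?exprn_ge0.
- exact: cvg_cst.
- by apply: cvg_geometric; rewrite ger0_norm.
Qed.

(** * Superadditive sequences and Fekete's lemma *)

Lemma superadditive_mulnD {R : numDomainType} (u : nat -> R) (m : nat) :
  (forall n, 0 <= u n) -> (forall m n, u m + u n <= u (m + n)%N) ->
  forall q r, q%:R * u m <= u (q * m + r)%N.
Proof.
move=> u0 uD; elim=> [|q IHq] r; first by rewrite mul0r.
rewrite mulSn -addnA -natr1 mulrDl mul1r addrC.
by apply: le_trans (uD _ _); rewrite lerD2l.
Qed.

(** Choose [m] with [u m / m] within [e / 2] of the supremum. Division of [n] by [m] loses less than
    one block, worth [u m], which is below [e / 2 * n] for large [n]. Ranging over [n.+1] excludes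
    the quotient at 0. *)
Lemma fekete {R : realType} (u : nat -> R) (C : R) :
  (forall n, 0 <= u n <= C * n%:R) ->
  (forall m n, u m + u n <= u (m + n)%N) ->
  (u n / n%:R @[n --> \oo] --> sup (range (fun n => u n.+1 / n.+1%:R)))%classic.
Proof.
move=> uC uD; set s := sup _.
have u0 n : 0 <= u n by have /andP[] := uC n.
have hs : has_sup (range (fun n => u n.+1 / n.+1%:R)).
  split; first by exists (u 1%N / 1%:R), 0%N.
  exists C => _ [n _ <-]; rewrite ler_pdivrMr ?ltr0n//.
  by have /andP[] := uC n.+1.
apply/cvgrPdist_lt => e e0; have e20 : 0 < e / 2 by lra.
have [_ [k _ <-]] := sup_adherent e20 hs; rewrite -/s => sk.
set m := k.+1 in sk; have m0 : (0 : R) < m%:R by rewrite ltr0n.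
have um : u m = u m / m%:R * m%:R by rewrite divfK ?gt_eqF.
near=> n.
have n0 : (0 < n)%N by near: n; exact: nbhs_infty_gt.
have nR : (0 : R) < n%:R by rewrite ltr0n.
have ns : u n / n%:R <= s.
  by apply: sup_upper_bound => //; exists n.-1 => //; rewrite prednK.
have nB : u m < e / 2 * n%:R.
  rewrite mulrC -ltr_pdivrMr//; near: n; exact: nbhs_infty_gtr.
have := superadditive_mulnD u m u0 uD (n %/ m) (n %% m); rewrite -divn_eq.
have : (n %/ m)%:R * m%:R + m%:R > n%:R :> R.
  by rewrite -natrM -natrD ltr_nat {1}(divn_eq n m) ltn_add2l ltn_mod.
have cm : 0 <= u m / m%:R by rewrite divr_ge0// ltW.
move: sk um cm nB; set c := u m / m%:R; move: (n %/ m)%:R => q sk um cm nB qm qn.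
rewrite um in qn nB.
rewrite ger0_norm ?subr_ge0// ltrBlDr -ltrBlDl ltr_pdivlMr//.
have : c * n%:R <= c * (q * m%:R + m%:R) by rewrite ler_wpM2l// ltW.
have : (s - e / 2) * n%:R < c * n%:R by rewrite ltr_pM2r.
by lra.
Unshelve. all: by end_near.
Qed.

(** * Common subsequences of a family *)

Lemma lcs_le_size {T : finType} {d : nat} (A : 'I_d -> seq T) (i : 'I_d) :
  (lcs A <= size (A i))%N.
Proof. by have [s /forallP sA <-] := lcsP A; exact: size_subseq. Qed.

Lemma lcs_cat {T : finType} {d : nat} (A B : 'I_d -> seq T) : (0 < d)%N ->
  (lcs A + lcs B <= lcs (fun i => A i ++ B i))%N.
Proof.
move=> d0; have [s /forallP sA <-] := lcsP A; have [t /forallP tB <-] := lcsP B.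
rewrite -size_cat; apply: lcs_max => //.
by apply/forallP => i; exact: cat_subseq.
Qed.

Lemma lcs_gt0 {T : finType} {d : nat} (A : 'I_d -> seq T) (x : T) : (0 < d)%N ->
  (forall i, x \in A i) -> (0 < lcs A)%N.
Proof.
move=> d0 xA; apply: (lcs_max (s := [:: x])) => //.
by apply/forallP => i; rewrite sub1seq.
Qed.

(** * Two words: LCS recurrence and indel distance *)

Definition lcs2 {T : finType} (A B : seq T) : nat :=
  lcs (fun i : 'I_2 => if i == ord0 then A else B).

Lemma lcs2P {T : finType} (A B : seq T) :
  exists s, [/\ subseq s A, subseq s B & size s = lcs2 A B].
Proof.
rewrite /lcs2; have [s /forallP sAB <-] := lcsP
  (fun i : 'I_2 => if i == ord0 then A else B).
by exists s; split => //; [have := sAB ord0|have := sAB ord_max].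
Qed.

Lemma lcs2_max {T : finType} {A B s : seq T} :
  subseq s A -> subseq s B -> (size s <= lcs2 A B)%N.
Proof.
by move=> sA sB; apply: lcs_max => //; apply/forallP => i; case: ifP.
Qed.

Lemma lcs2_le_size {T : finType} (A B : seq T) :
  (lcs2 A B <= size A)%N /\ (lcs2 A B <= size B)%N.
Proof.
by have [s [sA sB <-]] := lcs2P A B; split; exact: size_subseq.
Qed.

Lemma lcs2_cons {T : finType} (a b : T) (A B : seq T) :
  [|| lcs2 (a :: A) (b :: B) <= lcs2 A (b :: B),
      lcs2 (a :: A) (b :: B) <= lcs2 (a :: A) B |
      (a == b) && (lcs2 (a :: A) (b :: B) <= (lcs2 A B).+1)]%N.
Proof.
have [[|c s] [sA sB <-]] := lcs2P (a :: A) (b :: B); first by rewrite leq0n.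
have sA' := sA; rewrite /= in sA'; case: eqP sA' => [ca|_] sA'; last first.
  by rewrite (lcs2_max sA' sB).
subst c; have sB' := sB; rewrite /= in sB'; case: eqP sB' => [_|_] sB'; last first.
  by rewrite (lcs2_max sA sB') orbT.
by rewrite /= ltnS (lcs2_max sA' sB') !orbT.
Qed.

(* Fewest insertions and deletions turning [A] into [B]; the subtraction never
   truncates. *)
Definition indel {T : finType} (A B : seq T) : nat :=
  (size A + size B - (lcs2 A B).*2)%N.

Lemma indel0s {T : finType} (B : seq T) : indel [::] B = size B.
Proof. by rewrite /indel; have [] := @lcs2_le_size T [::] B => /=; lia. Qed.

Lemma indels0 {T : finType} (A : seq T) : indel A [::] = size A.
Proof. by rewrite /indel; have [] := @lcs2_le_size T A [::] => /=; lia. Qed.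

(** The recurrence bounds the weight by one of the three terms. Replacing their maximum by their sum
    makes the bound linear, so that it can be summed over all words. *)
Lemma expr_indel_cons {R : realFieldType} {T : finType} (y : R) (a b : T)
    (A B : seq T) : 0 <= y <= 1 ->
  y ^+ indel (a :: A) (b :: B) <=
    y * y ^+ indel A (b :: B) + y * y ^+ indel (a :: A) B
    + (a == b)%:R * y ^+ indel A B.
Proof.
move=> y01; have /andP[y0 y1] := y01; rewrite -!exprS.
have z0 n : 0 <= y ^+ n by rewrite exprn_ge0.
have ym m n : (m <= n)%N -> y ^+ n <= y ^+ m by move=> mn; rewrite ler_wiXn2l.
have [la lb] := lcs2_le_size A (b :: B); have [la' lb'] := lcs2_le_size (a :: A) B.
have [la2 lb2] := lcs2_le_size A B.
have [la3 lb3] := lcs2_le_size (a :: A) (b :: B).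
have ab0 : 0 <= (a == b)%:R * y ^+ indel A B by rewrite mulr_ge0.
rewrite /= in la lb la' lb' la2 lb2 la3 lb3.
case/or3P: (lcs2_cons a b A B) => [h|h|/andP[-> h]].
- rewrite -addrA ler_wpDr ?addr_ge0// ym// /indel /=; lia.
- rewrite addrAC addrC ler_wpDr ?addr_ge0// ym// /indel /=; lia.
- rewrite mul1r ler_wpDl ?addr_ge0// ym// /indel /=; lia.
Qed.

(** * Total indel weight of all pairs of words *)

Lemma big_tuple_cons {R : nmodType} {T : finType} (n : nat) (F : seq T -> R) :
  \sum_(A : n.+1.-tuple T) F A = \sum_(a : T) \sum_(A : n.-tuple T) F (a :: A).
Proof.
rewrite pair_bigA (reindex (fun p : T * n.-tuple T => [tuple of p.1 :: p.2]))//=.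
exists (fun A : n.+1.-tuple T => (thead A, [tuple of behead A])) => [[a A]|A] _.
  by rewrite theadE; congr pair; exact: val_inj.
by rewrite [RHS]tuple_eta; exact: val_inj.
Qed.

Lemma big_tuple0 {R : nmodType} {T : finType} (F : seq T -> R) :
  \sum_(A : 0.-tuple T) F A = F [::].
Proof.
rewrite (bigD1 [tuple]) //= big1 ?addr0// => A.
by rewrite (tuple0 A) => /eqP[]; exact: val_inj.
Qed.

Definition sum_indel {R : realFieldType} (T : finType) (y : R) (m n : nat) : R :=
  \sum_(A : m.-tuple T) \sum_(B : n.-tuple T) y ^+ indel A B.

Lemma sum_indelSS {R : realFieldType} (T : finType) (y : R) (m n : nat) :
  0 <= y <= 1 ->
  sum_indel T y m.+1 n.+1 <= #|T|%:R * (y * sum_indel T y m n.+1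
    + y * sum_indel T y m.+1 n + sum_indel T y m n).
Proof.
move=> y01; rewrite /sum_indel.
rewrite (big_tuple_cons m (fun A => \sum_(B : n.+1.-tuple T) y ^+ indel A B)).
under eq_bigr => a _ do under eq_bigr => A _ do
  rewrite (big_tuple_cons n (fun B => y ^+ indel (a :: A) B)).
apply: (@le_trans _ _ (\sum_(a : T) \sum_(A : m.-tuple T) \sum_(b : T)
  \sum_(B : n.-tuple T) (y * y ^+ indel A (b :: B) + y * y ^+ indel (a :: A) B
    + (a == b)%:R * y ^+ indel A B))).
  by do 4!apply: ler_sum => ? _; exact: expr_indel_cons.
have -> : forall E1 E2 E3 : T -> m.-tuple T -> T -> n.-tuple T -> R,
    \sum_a \sum_A \sum_b \sum_B (E1 a A b B + E2 a A b B + E3 a A b B)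
    = \sum_a \sum_A \sum_b \sum_B E1 a A b B
      + \sum_a \sum_A \sum_b \sum_B E2 a A b B
      + \sum_a \sum_A \sum_b \sum_B E3 a A b B.
  by move=> E1 E2 E3; do 4!(rewrite -!big_split /=; apply: eq_bigr => ? _).
rewrite le_eqVlt; apply/orP; left; apply/eqP; rewrite 2!mulrDr.
(* Each term has one free letter, whence the factor [#|T|]: [a] in the first, [b] in the second, the
   common value of [a] and [b] in the third. *)
congr (_ + _ + _).
- rewrite sumr_const -[LHS]mulr_natl; congr (_ * _); rewrite mulr_sumr; apply: eq_bigr => A _.
  rewrite (big_tuple_cons n (fun B => y ^+ indel A B)) mulr_sumr.
  by apply: eq_bigr => b _; rewrite mulr_sumr.
- rewrite (big_tuple_cons m (fun A => \sum_(B : n.-tuple T) y ^+ indel A B)).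
  rewrite !mulr_sumr; apply: eq_bigr => a _; rewrite !mulr_sumr.
  apply: eq_bigr => A _; rewrite sumr_const -[LHS]mulr_natl; congr (_ * _).
  by rewrite mulr_sumr.
- rewrite [RHS]mulr_natl -sumr_const; apply: eq_bigr => a _.
  apply: eq_bigr => A _; rewrite (bigD1 a)//= [X in _ + X]big1 => [|b /negbTE ba].
    by rewrite addr0; apply: eq_bigr => B _; rewrite eqxx mul1r.
  by apply: big1 => B _; rewrite eq_sym ba mul0r.
Qed.

Lemma sum_indel0n {R : realFieldType} (T : finType) (y : R) (n : nat) :
  sum_indel T y 0 n = (#|T|%:R * y) ^+ n.
Proof.
rewrite /sum_indel (big_tuple0 (fun A => \sum_(B : n.-tuple T) y ^+ indel A B)).
under eq_bigr => B _ do rewrite indel0s size_tuple.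
by rewrite sumr_const card_tuple -[LHS]mulr_natl natrX exprMn.
Qed.

Lemma sum_indeln0 {R : realFieldType} (T : finType) (y : R) (m : nat) :
  sum_indel T y m 0 = (#|T|%:R * y) ^+ m.
Proof.
rewrite /sum_indel.
under eq_bigr => A _ do
  rewrite (big_tuple0 (fun B => y ^+ indel A B)) indels0 size_tuple.
by rewrite sumr_const card_tuple -[LHS]mulr_natl natrX exprMn.
Qed.

(** The right-hand side is a supersolution of the recursion: after division by common factors, the
    last hypothesis is exactly the induction step, while [y <= r] settles the boundary. *)
Lemma sum_indel_le {R : realFieldType} (T : finType) (y r : R) (m n : nat) :
  0 <= y <= r -> r <= 1 -> 2 * y * r * #|T|%:R + 1 <= r ^+ 2 * #|T|%:R ->
  sum_indel T y m n <= (#|T|%:R * r) ^+ (m + n).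
Proof.
move=> /andP[y0 yr] r1 hr; set c : R := #|T|%:R.
have c0 : 0 <= c by [].
have r0 : 0 <= r by exact: le_trans yr.
have cyr : 0 <= c * y <= c * r by rewrite mulr_ge0//= ler_wpM2l.
have /andP[cy0 cyr'] := cyr.
elim: m n => [|m IHm] n; first by rewrite sum_indel0n lerXn2r// nnegrE mulr_ge0.
elim: n => [|n IHn]; first by rewrite sum_indeln0 addn0 lerXn2r// nnegrE mulr_ge0.
apply: le_trans (sum_indelSS T y m n _) _; first by rewrite y0 (le_trans yr).
have := IHm n; have := IHm n.+1; rewrite -/c !addSn !addnS in IHn *.
move: (m + n)%N IHn => k; rewrite !exprS; set L := (c * r) ^+ k.
move: (sum_indel T y m n.+1) (sum_indel T y m.+1 n) (sum_indel T y m n).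
move=> g1 g2 g3 h2 h1 h3.
have L0 : 0 <= L by rewrite exprn_ge0 ?mulr_ge0.
apply: (@le_trans _ _ (c * (y * (c * r * L) + y * (c * r * L) + L))).
  by rewrite ler_wpM2l// !lerD// ler_wpM2l.
have -> : c * (y * (c * r * L) + y * (c * r * L) + L)
    = c * L * (2 * y * r * c + 1) by ring.
have -> : c * r * (c * r * L) = c * L * (r ^+ 2 * c) by ring.
by rewrite ler_wpM2l// mulr_ge0.
Qed.

(** * Mean LCS of two random words *)

Lemma sum_ffun2 {R : nmodType} {T : finType} (F : {ffun 'I_2 -> T} -> R) :
  \sum_(A : {ffun 'I_2 -> T}) F A
  = \sum_(a : T) \sum_(b : T) F [ffun i => if i == ord0 then a else b].
Proof.
rewrite pair_bigA.
rewrite (reindex (fun p : T * T => [ffun i => if i == ord0 then p.1 else p.2]))//=.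
exists (fun A : {ffun 'I_2 -> T} => (A ord0, A ord_max)) => [[a b]|A] _.
  by rewrite !ffunE.
by apply/ffunP => i; rewrite ffunE; case: eqP => [->//|]; case: i => [[|[|]]]//= ? h;
  [case: h|]; try congr (A _); exact: val_inj.
Qed.

Lemma expected_lcs2E {R : realType} (n sigma : nat) :
  expected_lcs R n sigma 2 = (\sum_(A : n.-tuple 'I_sigma)
    \sum_(B : n.-tuple 'I_sigma) (lcs2 A B)%:R) / (sigma%:R ^+ n) ^+ 2.
Proof.
rewrite /expected_lcs card_ffun !card_ord card_tuple card_ord !natrX.
congr (_ / _); rewrite sum_ffun2; apply: eq_bigr => A _; apply: eq_bigr => B _.
by congr (lcs _)%:R; apply/funext => i; rewrite ffunE; case: ifP.
Qed.

(** The mean of [r ^+ (12 * indel A B)] is at most [r ^+ (2 * n)], so by convexity [12 * indel A B]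
    has mean at least [2 * n]. Since the indel distance is [2 * n - 2 * lcs2 A B], the mean LCS is
    at most [n - n / 12]. *)
Lemma expected_lcs2_le {R : realType} (n sigma : nat) : (2 <= sigma)%N ->
  expected_lcs R n sigma 2 <= 11 / 12 * n%:R.
Proof.
move=> s2; have s2R : (2 : R) <= sigma%:R by rewrite ler_nat.
rewrite expected_lcs2E; set N : R := sigma%:R ^+ n.
have N0 : 0 < N by rewrite exprn_gt0//; lra.
have NN0 : 0 < N ^+ 2 by exact: exprn_gt0.
rewrite ler_pdivrMr//; set S : R := \sum_(A : n.-tuple 'I_sigma)
  \sum_(B : n.-tuple 'I_sigma) (lcs2 A B)%:R.
(* For [sigma >= 2], [r = 3/4] and [y = r ^ 12] satisfy the hypothesis of
   [sum_indel_le]; the affine minorant at [2 n] then replaces Jensen. *)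
pose r : R := 3 / 4; pose y := r ^+ 12.
have y0 : 0 <= y by rewrite exprn_ge0 /r//; lra.
have y24 : y <= 1 / 24 by rewrite /y /r; lra.
have := @sum_indel_le R 'I_sigma y r n n; rewrite card_ord.
have -> : (0 <= y <= r) by rewrite y0/= /r; lra.
move=> /(_ isT); have -> : r <= 1 by rewrite /r; lra.
move=> /(_ isT); have -> : 2 * y * r * sigma%:R + 1 <= r ^+ 2 * sigma%:R.
  have : y * sigma%:R <= 1 / 24 * sigma%:R by rewrite ler_wpM2r.
  by rewrite /r; nra.
move=> /(_ isT); rewrite exprMn (exprD sigma%:R) -/N.
have r01 : 0 <= r <= 1 by rewrite /r; lra.
(* With [l = lcs2 A B], the coefficients come from [1 + (2 * n - 12 * (2 * n - 2 * l)) / 4]. *)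
have : \sum_(A : n.-tuple 'I_sigma) \sum_(B : n.-tuple 'I_sigma)
    (r ^+ (n + n) * (1 - 11 / 2 * n%:R) + r ^+ (n + n) * 6 * (lcs2 A B)%:R)
    <= sum_indel 'I_sigma y n n.
  apply: ler_sum => A _; apply: ler_sum => B _; rewrite /y -exprM.
  apply: le_trans (expr_ge_affine r _ (n + n) r01).
  rewrite -[X in _ + X <= _]mulrA -mulrDr ler_wpM2l//.
    by rewrite exprn_ge0//; lra.
  have [lA lB] := lcs2_le_size A B; rewrite !size_tuple in lA lB.
  rewrite /indel !size_tuple natrM natrB -?addnn ?leq_add// !natrD /r.
  by lra.
under eq_bigr => A _ do rewrite big_split /= sumr_const card_tuple card_ord
  -[_ *+ (sigma ^ n)%N]mulr_natr natrX -/N -mulr_sumr.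
rewrite big_split /= sumr_const card_tuple card_ord.
rewrite -[_ *+ (sigma ^ n)%N]mulr_natr natrX -/N -mulr_sumr -/S => h1 h2.
have {h1 h2} := le_trans h1 h2; have : 0 < r ^+ (n + n).
  by rewrite exprn_gt0// /r; lra.
move: (r ^+ _) => P P0 h.
have : P * ((1 - 11 / 2 * n%:R) * N * N + 6 * S - N * N) <= 0 by lra.
by rewrite pmulr_rle0// expr2; lra.
Qed.

(** * Mean LCS of [d] random words *)

(** Cutting every word after [m] letters is a bijection: concatenation is injective and the
    cardinalities agree. *)
Lemma sum_ffun_cat {R : nmodType} {T : finType} (d m n : nat)
    (F : ('I_d -> seq T) -> R) :
  \sum_(A : {ffun 'I_d -> (m + n).-tuple T}) F (fun i => A i)
  = \sum_(A : {ffun 'I_d -> m.-tuple T}) \sum_(B : {ffun 'I_d -> n.-tuple T})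
      F (fun i => A i ++ B i).
Proof.
pose h (p : {ffun 'I_d -> m.-tuple T} * {ffun 'I_d -> n.-tuple T}) :=
  [ffun i => [tuple of p.1 i ++ p.2 i]] : {ffun 'I_d -> (m + n).-tuple T}.
have hI : injective h.
  move=> [A B] [A' B'] /ffunP hAB.
  have hi i : A i = A' i /\ B i = B' i.
    have /(congr1 val) /eqP := hAB i.
    rewrite !ffunE /= eqseq_cat ?size_tuple// => /andP[/eqP a /eqP b].
    by split; exact: val_inj.
  by congr pair; apply/ffunP => i; have [] := hi i.
have hB : bijective h.
  apply: inj_card_bij => //.
  by rewrite card_prod !card_ffun !card_ord !card_tuple expnD expnMn.
rewrite pair_bigA (reindex h)/=; last exact: onW_bij.
by apply: eq_bigr => p _; congr F; apply/funext => i; rewrite ffunE.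
Qed.

Section expected_lcs.
Context {R : realType} (sigma d : nat).
Hypotheses (sigma0 : (0 < sigma)%N) (d0 : (0 < d)%N).

Let card n : R := ((sigma ^ n) ^ d)%:R.

Let card_gt0 n : 0 < card n.
Proof. by rewrite ltr0n !expn_gt0 sigma0. Qed.

Let cardE n : #|{: {ffun 'I_d -> n.-tuple 'I_sigma}}|%:R = card n.
Proof. by rewrite card_ffun card_tuple !card_ord. Qed.

Let sum_card n a : \sum_(A : {ffun 'I_d -> n.-tuple 'I_sigma}) a = a * card n.
Proof. by rewrite sumr_const -cardE mulr_natr. Qed.

Lemma expected_lcs_ge0_le (n : nat) : 0 <= expected_lcs R n sigma d <= 1 * n%:R.
Proof.
rewrite /expected_lcs cardE; apply/andP; split.
  by rewrite divr_ge0 ?sumr_ge0// ltW.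
rewrite mul1r ler_pdivrMr// -sum_card.
apply: ler_sum => A _; rewrite ler_nat.
by have := lcs_le_size (fun i => A i : seq _) (Ordinal d0); rewrite size_tuple.
Qed.

Lemma expected_lcs_superadditive (m n : nat) :
  expected_lcs R m sigma d + expected_lcs R n sigma d
  <= expected_lcs R (m + n)%N sigma d.
Proof.
rewrite /expected_lcs !cardE ler_pdivlMr//.
have -> : card (m + n) = card m * card n by rewrite /card -natrM expnD expnMn.
rewrite (sum_ffun_cat d m n (fun A => (lcs A)%:R)) mulrDl.
rewrite mulrA divfK ?gt_eqF// [X in _ + _ * X]mulrC mulrA divfK ?gt_eqF//.
apply: (@le_trans _ _ (\sum_(A : {ffun 'I_d -> m.-tuple 'I_sigma})
  \sum_(B : {ffun 'I_d -> n.-tuple 'I_sigma})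
    ((lcs (fun i => A i : seq 'I_sigma))%:R
     + (lcs (fun i => B i : seq 'I_sigma))%:R))).
  under [leRHS]eq_bigr => A _ do rewrite big_split /= sum_card.
  by rewrite big_split /= sum_card mulr_suml.
apply: ler_sum => A _; apply: ler_sum => B _.
by rewrite -natrD ler_nat lcs_cat.
Qed.

(** [lim] has a default value on divergent sequences; Fekete's lemma shows that the constant is a
    genuine limit. *)
Lemma lcs_gamma_cvg :
  (expected_lcs R n sigma d / n%:R @[n --> \oo] --> lcs_gamma R sigma d)%classic.
Proof.
rewrite /lcs_gamma; apply/cvgP.
exact: fekete expected_lcs_ge0_le expected_lcs_superadditive.
Qed.

(** Fekete's limit is a supremum, so every single length gives a lower bound. *)
Lemma lcs_gamma_ge (n : nat) : (0 < n)%N ->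
  expected_lcs R n sigma d / n%:R <= lcs_gamma R sigma d.
Proof.
move=> n0; rewrite /lcs_gamma.
rewrite (cvg_lim _ (fekete _ _ expected_lcs_ge0_le expected_lcs_superadditive))//.
apply: ub_le_sup; last by exists n.-1 => //; rewrite prednK.
exists 1 => _ [k _ <-]; rewrite ler_pdivrMr ?ltr0n//.
by have /andP[] := expected_lcs_ge0_le k.+1.
Qed.

(* The left-hand side is the probability that a fixed letter occurs in all [d]
   strings, which forces a common subsequence of length 1. *)
Lemma expected_lcs_ge (n : nat) :
  (1 - (1 - sigma%:R^-1) ^+ n) ^+ d <= expected_lcs R n sigma d.
Proof.
pose x := Ordinal sigma0.
(* Words avoiding [x] are counted through their indicator, one letter at a time. *)
have notin k : \sum_(A : k.-tuple 'I_sigma) (x \notin (A : seq _))%:R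
    = (sigma%:R - 1) ^+ k :> R.
  elim: k => [|k IHk].
    by rewrite (big_tuple0 (fun A => (x \notin A)%:R)) expr0.
  rewrite (big_tuple_cons k (fun A => (x \notin A)%:R)) exprS -IHk.
  under eq_bigr => a _ do under eq_bigr => A _ do
    rewrite inE negb_or -mulnb natrM.
  under eq_bigr => a _ do rewrite -mulr_sumr.
  rewrite -mulr_suml; congr (_ * _).
  rewrite (bigD1 x)// eqxx /= mulr0n add0r.
  rewrite (eq_bigr (fun=> 1)) => [|a]; last by rewrite eq_sym => ->.
  by rewrite sumr_const cardC1 card_ord -subn1 natrB.
have sR : (0 : R) < sigma%:R by rewrite ltr0n.
rewrite /expected_lcs cardE ler_pdivlMr//.
have -> : (1 - (1 - sigma%:R^-1) ^+ n) ^+ d * card n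
    = \prod_(i < d) \sum_(A : n.-tuple 'I_sigma) (x \in (A : seq _))%:R.
  rewrite prodr_const card_ord /card !natrX -exprMn; congr (_ ^+ _).
  rewrite mulrBl mul1r -exprMn mulrBl mul1r mulVf ?gt_eqF// -notin.
  apply/eqP; rewrite subr_eq -big_split /=; apply/eqP.
  rewrite (eq_bigr (fun=> 1)) => [|A _]; last by case: (x \in _) => /=; lra.
  by rewrite sumr_const card_tuple card_ord natrX.
(* The product of sums expands into a sum over families of the indicator that [x] occurs in every
   word, which is at most the LCS length. *)
rewrite bigA_distr_bigA; apply: ler_sum => A _ /=.
rewrite -natr_prod ler_nat.
have [/forallP xA|/forallPn[i /negbTE xA]] := boolP [forall i, x \in (A i : seq _)].
  by rewrite big1 => [|i _]; [exact: lcs_gt0 xA|rewrite xA].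
by rewrite (bigD1 i)//= xA mul0n.
Qed.

End expected_lcs.

(** * Bounds on the constants and their comparison *)

Lemma lcs_gamma2_le {R : realType} (sigma : nat) : (2 <= sigma)%N ->
  0 <= lcs_gamma R sigma 2 <= 11 / 12.
Proof.
move=> s2; have s0 : (0 < sigma)%N by exact: ltnW.
have cv := @lcs_gamma_cvg R sigma 2 s0 isT; apply/andP; split.
  apply: le_trans (lcs_gamma_ge sigma 2 s0 _ 1 _) => //.
  by rewrite invr1 mulr1; have /andP[] := @expected_lcs_ge0_le R sigma 2 s0 isT 1.
apply: limr_le; first by apply/cvg_ex; eexists; exact: cv.
near=> n; have n0 : (0 < n)%N by near: n; exact: nbhs_infty_gt.
by rewrite ler_pdivrMr ?ltr0n// expected_lcs2_le.
Unshelve. all: by end_near.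
Qed.

(** Take words of length [d]. If [q] is the probability that one of them misses a fixed letter,
    Bernoulli's inequality gives [(1 - q) ^+ d >= 1 - d * q]. *)
Lemma lcs_gamma_lower {R : realType} (sigma d : nat) : (0 < sigma)%N -> (0 < d)%N ->
  1 - d%:R * (1 - sigma%:R^-1) ^+ d <= lcs_gamma R sigma d * d%:R.
Proof.
move=> s0 d0; have dR : (0 : R) < d%:R by rewrite ltr0n.
rewrite -ler_pdivrMr//; apply: le_trans (lcs_gamma_ge sigma d s0 d0 d d0).
rewrite ler_pM2r ?invr_gt0//; apply: le_trans (expected_lcs_ge _ _ s0 d0 d).
set q := (1 - sigma%:R^-1) ^+ d.
have s1 : 0 <= 1 - (sigma%:R : R)^-1 <= 1.
  by rewrite subr_ge0 gerBl invr_ge0 ler0n andbT invf_le1 ?ltr0n// ler1n.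
have q1 : 0 <= q <= 1.
  by have /andP[a b] := s1; rewrite exprn_ge0//= exprn_ile1.
have q1' : 0 <= 1 - q <= 1 by lra.
by have := bernoulli_ge (1 - q) d q1'; have -> : 1 - (1 - q) = q by ring.
Qed.

Theorem mainTheorem2 (R : realType) (sigma : nat) (hsigma : (2 <= sigma)%N) :
  (exists d0 : nat, forall d : nat, (d0 <= d)%N ->
     lcs_gamma R sigma 2 ^+ (d - 1) < lcs_gamma R sigma d) /\
  (exists d0 : nat, forall d : nat, (d0 <= d)%N ->
     lcs_gamma R sigma d <> lcs_gamma R sigma 2 ^+ (d - 1)).
Proof.
suff [d0 hd0] : exists d0 : nat, forall d : nat, (d0 <= d)%N ->
    lcs_gamma R sigma 2 ^+ (d - 1) < lcs_gamma R sigma d.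
  split; exists d0 => // d /hd0 hd e; by rewrite e ltxx in hd.
have s0 : (0 < sigma)%N by exact: ltnW.
have /andP[g0 g1] := @lcs_gamma2_le R sigma hsigma.
set g := lcs_gamma R sigma 2 in g0 g1 *; pose q : R := 1 - sigma%:R^-1.
have q01 : 0 <= q < 1.
  rewrite subr_ge0 gtrBl invr_gt0 ltr0n s0 andbT invf_le1 ?ltr0n// ler1n//.
have c01 : 0 <= (11 / 12 : R) < 1 by lra.
have e4 : (0 : R) < 1 / 4 by lra.
have /cvgr0_norm_lt /(_ _ e4) hq := cvg_natr_expr q q01.
have /cvgr0_norm_lt /(_ _ e4) hc := cvg_natr_expr _ c01.
suff : (\forall d \near \oo, g ^+ (d - 1) < lcs_gamma R sigma d)%classic.
  by move=> [d0 _ hd0]; exists d0 => d; exact: hd0.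
near=> d.
have d0 : (0 < d)%N by near: d; exact: nbhs_infty_gt.
have dR : (0 : R) < d%:R by rewrite ltr0n.
have q4 : d%:R * q ^+ d < 1 / 4.
  by apply: le_lt_trans (ler_norm _) _; near: d; exact: hq.
have c4 : d%:R * (11 / 12) ^+ d < 1 / 4 :> R.
  by apply: le_lt_trans (ler_norm _) _; near: d; exact: hc.
have := @lcs_gamma_lower R sigma d s0 d0; rewrite -/q => lo.
(* After multiplication by [d], the right-hand side exceeds [3 / 4], whereas the left-hand side is
   below [12 / 11 * (1 / 4)]. *)
rewrite -(ltr_pM2r dR); apply: lt_le_trans lo.
have : g ^+ (d - 1) <= (11 / 12) ^+ (d - 1) by rewrite lerXn2r// nnegrE; lra.
rewrite -(ler_pM2r dR) => /le_lt_trans; apply.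
have : (11 / 12) ^+ d = (11 / 12) ^+ (d - 1) * (11 / 12) :> R.
  by rewrite -exprSr subn1 prednK.
by move: c4 q4; move: (_ ^+ d) (_ ^+ (d - 1)) (q ^+ d) => a b c; nra.
Unshelve. all: by end_near.
Qed.
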